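(* Let $H$ be a connected hypergraph with a minimal edge cut $F$, and let $H_i$, for $i \in I$, be the connected components of $H \backslash F$. Then $H$ has an Euler tour if and only if there exists $J \subseteq I$ with $1 \le |J| \le |F|$ such that (i) $H\left[ \bigcup_{j \in J} V(H_j)\right]$ has an Euler tour, and (ii) $H_i$ is empty (has no edges) for all $i \notin J$.
   Context: A hypergraph $H=(V,E)$: non-empty finite vertex set $V$ and finite multiset $E$ of subsets of $V$ (edges). Distinct $u,v$ are adjacent via $e$ if $u,v\in e$. A walk is $v_0e_1v_1\ldots e_kv_k$ with $v_{i-1},v_i$ adjacent via $e_i$; closed if $v_0=v_k$, $k\ge2$; trail if edges are pairwise distinct. An Euler tour is a closed trail traversing every edge. Connected components are maximal connected subhypergraphs without empty edges. For $V'\subseteq V$, $H[V']$ has vertex set $V'$ and edge multiset $\{\!\{e\cap V': e\in E, e\cap V'\ne\emptyset\}\!\}$. For $F\subseteq E$, $H\backslash F=(V,E-F)$. An edge cut is a set $[S,V-S]_H=\{e\in E: e\cap S\ne\emptyset\ne e\cap(V-S)\}$ for non-empty proper $S\subset V$; minimal if it properly contains no other edge cut.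
   Formalization: H is additionally assumed to have no empty edges; otherwise the claim fails: for V={a,b} with edges {a,b}, {a,b}, ∅, the induced H[V] drops ∅ and has an Euler tour, while H has none. *)

(* Defs.v *)
From mathcomp Require Import all_boot.

Set Implicit Arguments.
Unset Strict Implicit.
Unset Printing Implicit Defensive.

(* The edge multiset is a family of vertex subsets indexed by a finite set of
   labels, so parallel edges are distinct labels with equal [ends].  The value
   of [ends] on labels outside [edges] is irrelevant.  Well-formedness is the
   separate predicate [is_hypergraph]. *)
Record hypergraph (T L : finType) := Hypergraph {
  vertices : {set T};
  edges : {set L};
  ends : L -> {set T}
}.

Definition is_hypergraph (T L : finType) (H : hypergraph T L) : Prop :=
  vertices H != set0 /\
  (forall e, e \in edges H -> ends H e \subset vertices H).

(* An empty edge is never traversed by a walk but disappears in [induced]: with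
   vertices a, b and edges {a,b}, {a,b}, {}, the whole hypergraph has no Euler
   tour while the one induced by all its vertices has.  Hence this condition
   matters for relating Euler tours of H to those of its induced parts. *)
Definition no_empty_edges (T L : finType) (H : hypergraph T L) : Prop :=
  forall e, e \in edges H -> ends H e != set0.

Definition adjacent_via (T L : finType) (H : hypergraph T L) (e : L) (u v : T)
  : bool :=
  [&& e \in edges H, u != v, u \in ends H e & v \in ends H e].

(* The walk v_0 e_1 v_1 ... e_k v_k is represented by its initial vertex v_0
   and the sequence of pairs (e_1, v_1), ..., (e_k, v_k). *)
Fixpoint steps (T L : finType) (H : hypergraph T L) (v : T) (p : seq (L * T))
  : bool :=
  if p is (e, w) :: p' then adjacent_via H e v w && steps H w p' else true.

Definition walk (T L : finType) (H : hypergraph T L) (v : T) (p : seq (L * T))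
  : bool :=
  (v \in vertices H) && steps H v p.

Definition walk_end (T L : finType) (v : T) (p : seq (L * T)) : T :=
  last v [seq s.2 | s <- p].

Definition walk_edges (T L : finType) (p : seq (L * T)) : seq L :=
  [seq s.1 | s <- p].

Definition closed_walk (T L : finType) (H : hypergraph T L) (v : T)
    (p : seq (L * T)) : bool :=
  [&& walk H v p, walk_end v p == v & 2 <= size p].

Definition closed_trail (T L : finType) (H : hypergraph T L) (v : T)
    (p : seq (L * T)) : bool :=
  closed_walk H v p && uniq (walk_edges p).

Definition euler_tour (T L : finType) (H : hypergraph T L) (v : T)
    (p : seq (L * T)) : Prop :=
  closed_trail H v p /\ (forall e, e \in edges H -> e \in walk_edges p).

Definition has_euler_tour (T L : finType) (H : hypergraph T L) : Prop :=
  exists (v : T) (p : seq (L * T)), euler_tour H v p.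

Definition connected (T L : finType) (H : hypergraph T L) : Prop :=
  forall u v, u \in vertices H -> v \in vertices H ->
    exists p : seq (L * T), walk H u p /\ walk_end u p = v.

(* A subhypergraph of H = (V, E) has a vertex set V' included in V and the edge
   multiset {{ e :&: V' | e in E'' }} for some E'' included in E; it is
   determined by the pair (V', E''). *)
Definition sub_data (T L : finType) : finType := ({set T} * {set L})%type.

Definition sub (T L : finType) (H : hypergraph T L) (C : sub_data T L)
  : hypergraph T L :=
  Hypergraph C.1 C.2 (fun e => ends H e :&: C.1).

Definition is_sub (T L : finType) (H : hypergraph T L) (C : sub_data T L)
  : Prop :=
  [/\ C.1 != set0, C.1 \subset vertices H & C.2 \subset edges H].

Definition connected_sub (T L : finType) (H : hypergraph T L)
    (C : sub_data T L) : Prop :=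
  [/\ is_sub H C, connected (sub H C) & no_empty_edges (sub H C)].

(* For subhypergraphs C and D of H, C is a subhypergraph of D exactly when
   C.1 \subset D.1 and C.2 \subset D.2, since
   (ends H e :&: D.1) :&: C.1 = ends H e :&: C.1 as soon as C.1 \subset D.1. *)
Definition component (T L : finType) (H : hypergraph T L) (C : sub_data T L)
  : Prop :=
  connected_sub H C /\
  (forall D : sub_data T L, connected_sub H D ->
     C.1 \subset D.1 -> C.2 \subset D.2 -> D = C).

Definition induced (T L : finType) (H : hypergraph T L) (W : {set T})
  : hypergraph T L :=
  Hypergraph W [set e in edges H | ends H e :&: W != set0]
    (fun e => ends H e :&: W).

Definition del_edges (T L : finType) (H : hypergraph T L) (F : {set L})
  : hypergraph T L :=
  Hypergraph (vertices H) (edges H :\: F) (ends H).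

Definition cut (T L : finType) (H : hypergraph T L) (S : {set T}) : {set L} :=
  [set e in edges H | (ends H e :&: S != set0) &&
                      (ends H e :&: (vertices H :\: S) != set0)].

Definition edge_cut (T L : finType) (H : hypergraph T L) (F : {set L}) : Prop :=
  exists S : {set T}, [/\ S != set0, S \proper vertices H & F = cut H S].

Definition minimal_edge_cut (T L : finType) (H : hypergraph T L) (F : {set L})
  : Prop :=
  edge_cut H F /\ (forall F' : {set L}, edge_cut H F' -> ~~ (F' \proper F)).

(* Main.v *)
(** The connected components of H \ F are the classes of reachability by edges
    outside F.  The cut determined by a single class is contained in F, hence
    equals F by minimality: every edge of F meets every component.  So any
    nonempty union of components meets all edges of F, and an Euler tour of its
    induced hypergraph that misses only empty components is a tour of H.
    Conversely, an Euler tour of H can change component only along an edge of F;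
    being closed and traversing F, it enters each component that it visits by an
    edge of F, so it visits at most |F| components, and these form J. *)
Require Import Defs.
From mathcomp Require Import all_boot.

Set Implicit Arguments.
Unset Strict Implicit.
Unset Printing Implicit Defensive.

(** * Reachability classes and connected components *)

Section Reachability.

Variables (T L : finType).
Implicit Types (H : hypergraph T L) (S W : {set T}) (u v w : T) (e : L).

Definition adjacent H : rel T := fun u v => [exists e, adjacent_via H e u v].

Lemma adjacent_via_sym H e u v : adjacent_via H e u v = adjacent_via H e v u.
Proof. by rewrite /adjacent_via eq_sym [(u \in _) && _]andbC. Qed.

Lemma connect_adjacent_sym H : connect_sym (adjacent H).
Proof.
apply: sym_connect_sym => u v; apply: eq_existsb => e.
exact: adjacent_via_sym.
Qed.

Lemma connect_ends H e u v :
  e \in edges H -> u \in ends H e -> v \in ends H e -> connect (adjacent H) u v.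
Proof.
move=> eE ue ve; have [-> //|neq_uv] := eqVneq u v.
by apply/connect1/existsP; exists e; apply/and4P.
Qed.

Lemma steps_connect H u (p : seq (L * T)) :
  steps H u p -> connect (adjacent H) u (walk_end u p).
Proof.
elim: p u => [|[e w] p IHp] u //= /andP[uw /IHp].
by apply: connect_trans; apply/connect1/existsP; exists e.
Qed.

Lemma connect_steps H u v : connect (adjacent H) u v ->
  exists p : seq (L * T), steps H u p /\ walk_end u p = v.
Proof.
case/connectP=> q; elim: q u => [|w q IHq] u /=; first by exists [::].
case/andP=> /existsP[e uw] wq /(IHq _ wq)[p [Hp <-]].
by exists ((e, w) :: p); rewrite /= uw.
Qed.

Lemma connectedP H :
  connected H <-> {in vertices H &, forall u v, connect (adjacent H) u v}.
Proof.
split=> [cH u v uH vH | cH u v uH vH].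
  by have [p [/andP[_ /steps_connect up] <-]] := cH u v uH vH.
have [p [Hp pv]] := connect_steps (cH u v uH vH).
by exists p; rewrite /walk uH.
Qed.

Lemma connect_closed H S u v :
    (forall e x y, adjacent_via H e x y -> x \in S -> y \in S) ->
  connect (adjacent H) u v -> u \in S -> v \in S.
Proof.
move=> clS /connectP[p]; elim: p u => [|w p IHp] u /=; first by move=> _ ->.
case/andP=> /existsP[e uw] wp vE uS.
exact: IHp wp vE (clS _ _ _ uw uS).
Qed.

(* Both sides of a cut are closed under adjacency, so no walk crosses it. *)
Lemma cut_separates H S u v : is_hypergraph H ->
  connect (adjacent (del_edges H (cut H S))) u v -> u \in S -> v \in S.
Proof.
move=> [_ endsV]; apply: connect_closed => e x y.
case/and4P; rewrite /= !inE => /andP[eF eE] _ xe ye xS.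
apply: contraR eF => yS; rewrite eE /=; apply/andP; split; apply/set0Pn.
  by exists x; rewrite inE xe.
by exists y; rewrite !inE ye yS (subsetP (endsV e eE)).
Qed.

(** Deleting an empty cut changes nothing, so connectedness would lead from [S] to a vertex outside
    it without crossing the cut. *)
Lemma cut_neq0 H S : is_hypergraph H -> connected H ->
  S != set0 -> S \proper vertices H -> cut H S != set0.
Proof.
move=> hH /connectedP cH /set0Pn[s sS] /properP[SV [t tV tS]].
apply: contraNneq tS => cut0; apply: (cut_separates hH _ sS).
have:= cH s t (subsetP SV s sS) tV; rewrite cut0; apply: connect_sub => x y.
case/existsP=> e xy; apply/connect1/existsP; exists e.
by move: xy; rewrite /adjacent_via /= !inE.
Qed.

Definition reach_class H v : {set T} := [set u | connect (adjacent H) v u].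

(** An edge that meets the class lies inside it; asking it to meet the class merely excludes empty
    edges, which a component may not have. *)
Definition reach_component H v : sub_data T L :=
  (reach_class H v,
   [set e in edges H | ends H e :&: reach_class H v != set0]).

Lemma reach_class_ends H v e : e \in edges H ->
  ends H e :&: reach_class H v != set0 -> ends H e \subset reach_class H v.
Proof.
move=> eE /set0Pn[x /setIP[xe]]; rewrite inE => vx; apply/subsetP=> y ye.
rewrite inE; apply: connect_trans vx _; exact: connect_ends eE xe ye.
Qed.

Lemma reach_class_vertices H v : is_hypergraph H -> v \in vertices H ->
  reach_class H v \subset vertices H.
Proof.
move=> [_ endsV] vV; apply/subsetP=> u; rewrite inE => vu.
apply: (connect_closed _ vu vV) => e x y /and4P[eE _ _ ye] _.
exact: subsetP (endsV e eE) y ye.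
Qed.

Lemma reach_component_eq H u v :
  u \in reach_class H v -> reach_component H u = reach_component H v.
Proof.
rewrite inE => vu; have eq_uv: reach_class H u = reach_class H v.
  apply/setP=> w; rewrite !inE.
  by rewrite (same_connect (@connect_adjacent_sym H) vu).
by rewrite /reach_component eq_uv.
Qed.

(** Adjacency in [X] is also adjacency in [H], and each edge of [X] has a vertex in [X.1]. Thus
    [reach_component H v] dominates every connected subhypergraph through [v], which yields its
    maximality. *)
Lemma connected_sub_reach H X v : connected_sub H X -> v \in X.1 ->
  X.1 \subset reach_class H v /\ X.2 \subset (reach_component H v).2.
Proof.
move=> [[_ XV XE] /connectedP cX neX] vX.
have X1 : X.1 \subset reach_class H v.
  apply/subsetP=> u uX; rewrite inE; have:= cX v u vX uX.
  apply: connect_sub => x y /existsP[e /and4P[/= eX xy]].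
  rewrite !inE => /andP[xe _] /andP[ye _].
  exact: connect_ends (subsetP XE e eX) xe ye.
split=> //; apply/subsetP=> e eX; rewrite inE (subsetP XE) //=.
have /set0Pn[x /setIP[xe xX]] := neX e eX.
by apply/set0Pn; exists x; rewrite inE xe (subsetP X1).
Qed.

Lemma reach_component_connected H v : is_hypergraph H -> v \in vertices H ->
  connected_sub H (reach_component H v).
Proof.
move=> hH vV; split.
- split=> /=; last by apply/subsetP=> e; rewrite inE => /andP[].
    by apply/set0Pn; exists v; rewrite inE.
  exact: reach_class_vertices.
- apply/connectedP => u w /=; rewrite !inE => vu vw.
  suff reach_v x : connect (adjacent H) v x ->
      connect (adjacent (sub H (reach_component H v))) v x.
    apply: connect_trans (reach_v w vw).
    by rewrite connect_adjacent_sym reach_v.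
  move=> vx; set R := connect (adjacent (sub _ _)).
  (* The invariant also records reachability in [H]: it places both ends of the next step in the
     class, so that the step survives in the subhypergraph. *)
  have: x \in [set y | connect (adjacent H) v y && R v y].
    apply: (connect_closed _ vx); last by rewrite inE connect0 /R connect0.
    move=> e y z yz; rewrite !inE => /andP[vy vy'].
    have vz : connect (adjacent H) v z.
      by apply: connect_trans vy _; apply/connect1/existsP; exists e.
    rewrite vz /=; apply: connect_trans vy' _; apply/connect1/existsP; exists e.
    case/and4P: yz => eE yz ye ze; rewrite /adjacent_via /= yz !inE eE ye ze.
    rewrite vy vz !andbT /=; apply/set0Pn.
    by exists y; rewrite !inE ye.
  by rewrite inE => /andP[].
- by move=> e /=; rewrite inE => /andP[].
Qed.

Lemma componentP H X : is_hypergraph H ->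
  component H X <-> exists2 v, v \in vertices H & reach_component H v = X.
Proof.
move=> hH; split=> [[cX maxX]|[v vV <-]].
  have [[/set0Pn[v vX] XV _] _ _] := cX.
  have vV := subsetP XV v vX; exists v => //.
  have [X1 X2] := connected_sub_reach cX vX.
  exact: maxX (reach_component_connected hH vV) X1 X2.
split=> [|D cD D1 D2]; first exact: reach_component_connected.
have vD : v \in D.1 by apply: (subsetP D1); rewrite inE.
have [D1' D2'] := connected_sub_reach cD vD.
rewrite [D]surjective_pairing; congr pair; apply/eqP; rewrite eqEsubset.
  by rewrite D1 D1'.
by rewrite D2 D2'.
Qed.

End Reachability.

(** * Edges of a minimal cut meet every component *)

Section MinimalCut.

Variables (T L : finType) (H : hypergraph T L) (F : {set L}).
Hypotheses (hH : is_hypergraph H) (hF : minimal_edge_cut H F).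

Local Notation K := (del_edges H F).

Lemma is_hypergraph_del_edges : is_hypergraph K.
Proof. by case: hH => V0 endsV; split=> //= e /setDP[/endsV]. Qed.

Lemma minimal_cut_meets_class v e :
  v \in vertices H -> e \in F -> ends H e :&: reach_class K v != set0.
Proof.
case: hF => [[S [/set0Pn[s sS] /properP[SV [t tV tS]] defF]] minF] vV.
have WV := reach_class_vertices is_hypergraph_del_edges vV.
have cutW : edge_cut H (cut H (reach_class K v)).
  exists (reach_class K v); split=> //.
    by apply/set0Pn; exists v; rewrite inE.
  (* If the class were all of [vertices H], then [s] and [t] would be joined outside [F], although
     [F] separates them. *)
  rewrite properEneq WV andbT; apply: contraNneq tS => WE.
  have vP x : x \in vertices H -> connect (adjacent K) v x.
    by rewrite -WE inE.
  apply: (cut_separates hH _ sS); rewrite -defF.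
  apply: connect_trans (vP t tV).
  by rewrite connect_adjacent_sym vP // (subsetP SV).
(* An edge outside [F] that meets the class stays inside it and cannot cross. *)
have subF : cut H (reach_class K v) \subset F.
  apply/subsetP=> f; rewrite inE => /and3P[fE fW /set0Pn[x]].
  rewrite !inE => /and3P[xf xW _]; apply: contraNT xW => fF.
  have fK : f \in edges K by rewrite !inE fF.
  by have:= subsetP (reach_class_ends fK fW) x xf; rewrite inE.
have:= minF _ cutW; rewrite properEneq subF andbT negbK => /eqP defW.
by rewrite -{1}defW inE => /and3P[].
Qed.

Lemma minimal_cut_edges : F \subset edges H.
Proof.
by case: hF => [[S [_ _ ->]] _]; apply/subsetP=> e; rewrite inE => /andP[].
Qed.

End MinimalCut.

(** * Tours in induced hypergraphs and entries into components *)

Section Tours.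

Variables (T L : finType) (H : hypergraph T L).
Implicit Types (F : {set L}) (W : {set T}) (p : seq (L * T)).

Lemma steps_induced W v p : steps (induced H W) v p -> steps H v p.
Proof.
elim: p v => [|[e w] p IHp] v //= /andP[/and4P[/=]]; rewrite !inE.
move=> /andP[eE _] vw /andP[ve _] /andP[we _] /IHp ->.
by rewrite /adjacent_via eE vw ve we.
Qed.

Lemma induced_steps W v p : v \in W -> {subset [seq s.2 | s <- p] <= W} ->
  steps H v p -> steps (induced H W) v p.
Proof.
elim: p v => [|[e w] p IHp] v //= vW sW /andP[/and4P[eE vw ve we] Hp].
have wW : w \in W by apply: sW; rewrite inE eqxx.
rewrite IHp // ?andbT; last by move=> x xp; apply: sW; rewrite inE xp orbT.
rewrite /adjacent_via /= !inE eE vw ve we vW wW !andbT /=.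
by apply/set0Pn; exists v; rewrite inE ve.
Qed.

(** Inducing keeps edge labels, and no edge is lost when all meet [W]; the same sequence is
    therefore a tour of [H]. *)
Lemma euler_tour_of_induced W : W \subset vertices H ->
    (forall e, e \in edges H -> ends H e :&: W != set0) ->
  has_euler_tour (induced H W) -> has_euler_tour H.
Proof.
move=> WV meetW [v [p [/andP[/and3P[/andP[/= vW Hp] pv p2] Up] covp]]].
exists v, p; split.
  by rewrite /closed_trail /closed_walk /walk (subsetP WV) // (steps_induced Hp) pv p2.
by move=> e eE; apply: covp; rewrite /= inE eE meetW.
Qed.

Lemma edge_traversed e v p : steps H v p -> e \in walk_edges p ->
  exists2 w, w \in ends H e & w \in [seq s.2 | s <- p].
Proof.
elim: p v => [|[f w] p IHp] v //= /andP[/and4P[_ _ _ wf] Hp].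
rewrite inE => /predU1P[-> | ep]; first by exists w; rewrite ?inE ?eqxx.
by have [x xe xp] := IHp w Hp ep; exists x; rewrite // inE xp orbT.
Qed.

(** One entry per step along [F], with repetitions, even if the step stays in the same component. *)
Definition entered F p : seq (sub_data T L) :=
  [seq reach_component (del_edges H F) s.2 | s <- p & s.1 \in F].

Lemma steps_same_component F v p e w :
  steps H v ((e, w) :: p) -> e \notin F ->
  reach_component (del_edges H F) w = reach_component (del_edges H F) v.
Proof.
move=> /andP[/and4P[eE _ ve we] _] eF; apply: reach_component_eq.
by rewrite inE; apply: (@connect_ends _ _ _ e); rewrite //= inE eF.
Qed.

(** A step outside [F] stays in its component, so the current component is the latest one entered,
    or the initial one if there is none. *)
Lemma last_entered F v p : steps H v p ->
  reach_component (del_edges H F) (walk_end v p) =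
  last (reach_component (del_edges H F) v) (entered F p).
Proof.
elim: p v => [|[e w] p IHp] v // Hp.
have /IHp{}IHp : steps H w p by case/andP: Hp.
rewrite /walk_end /= in IHp *; rewrite IHp /entered /=.
case: ifPn => //= eF; congr last; exact: steps_same_component Hp eF.
Qed.

Lemma visited_entered F v p w : steps H v p -> w \in [seq s.2 | s <- p] ->
  reach_component (del_edges H F) w
    \in reach_component (del_edges H F) v :: entered F p.
Proof.
elim: p v => [|[e x] p IHp] v // Hp.
have /IHp{}IHp : steps H x p by case/andP: Hp.
rewrite [map _ _]/= inE => wp.
have {wp IHp} : reach_component (del_edges H F) w
    \in reach_component (del_edges H F) x :: entered F p.
  by case/predU1P: wp => [-> | /IHp //]; rewrite inE eqxx.
rewrite /entered /=; case: ifPn => [eF wx | eF]; first by rewrite inE wx orbT.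
by rewrite (steps_same_component Hp eF).
Qed.

(* The last component entered is that of the end [v], so the start of a closed
   walk needs no separate count. *)
Lemma closed_visited_entered F v p w : steps H v p -> walk_end v p = v ->
    entered F p != [::] -> w \in v :: [seq s.2 | s <- p] ->
  reach_component (del_edges H F) w \in entered F p.
Proof.
move=> Hp pv nil wp.
have vD : reach_component (del_edges H F) v \in entered F p.
  have:= last_entered F Hp; rewrite pv.
  by case: (entered F p) nil => //= x s _ ->; apply: mem_last.
move: wp; rewrite inE => /predU1P[-> // | /(visited_entered F Hp)].
by rewrite inE => /predU1P[-> | ].
Qed.

(** The steps along [F] carry pairwise distinct labels from [F]. *)
Lemma size_entered F p : uniq (walk_edges p) -> size (entered F p) <= #|F|.
Proof.
move=> Up; rewrite size_map -(size_map fst).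
have -> : [seq s.1 | s <- p & s.1 \in F] = [seq e <- walk_edges p | e \in F].
  by rewrite /walk_edges filter_map.
have /card_uniqP <- := filter_uniq (mem F) Up.
by apply: subset_leq_card; apply/subsetP=> e; rewrite mem_filter => /andP[].
Qed.

End Tours.

(** * Both directions of the equivalence *)

Theorem theorem5p3 (T L : finType) (H : hypergraph T L)
    (hH : is_hypergraph H) (hne : no_empty_edges H) (hconn : connected H)
    (F : {set L}) (hF : minimal_edge_cut H F)
    (I : finType) (C : I -> sub_data T L)
    (hCinj : injective C)
    (hC : forall X : sub_data T L,
            component (del_edges H F) X <-> exists i : I, C i = X) :
  has_euler_tour H <->
  exists J : {set I},
    [/\ 1 <= #|J| <= #|F|,
        has_euler_tour (induced H (\bigcup_(j in J) vertices (sub (del_edges H F) (C j))))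
      & forall i : I, i \notin J -> edges (sub (del_edges H F) (C i)) = set0].
Proof.
set K := del_edges H F.
have hK : is_hypergraph K by apply: is_hypergraph_del_edges.
have repC i : exists2 v, v \in vertices H & C i = reach_component K v.
  have /(componentP _ hK)[v vV <-] : component K (C i) by apply/hC; exists i.
  by exists v.
have indexC v : v \in vertices H -> exists i, C i = reach_component K v.
  by move=> vV; apply/hC/(componentP _ hK); exists v.
split=> [[v [p [/andP[/and3P[/andP[vV Hp] /eqP pv p2] Up] covp]]] | [J]].
  (* [J] indexes the components that the tour visits. *)
  pose J := [set i | has (mem (C i).1) (v :: [seq s.2 | s <- p])].
  have pV : {subset v :: [seq s.2 | s <- p] <= vertices H}.
    case: hH => _ endsV; elim: p v vV Hp {pv p2 Up covp J} => [|[e w] p IHp] v vV.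
      by move=> _ x; rewrite inE => /eqP->.
    move=> /andP[/and4P[eE _ _ we] Hp] x; rewrite inE => /predU1P[-> // | ].
    by apply: IHp => //; apply: (subsetP (endsV e eE)).
  have pJ w : w \in v :: [seq s.2 | s <- p] ->
      exists2 i, i \in J & w \in (C i).1.
    move=> wp; have [i Ci] := indexC w (pV w wp).
    have wC : w \in (C i).1 by rewrite Ci inE.
    by exists i; rewrite // inE; apply/hasP; exists w.
  (* [F] is non-empty because [H] is connected, and the tour traverses its edges. *)
  have nil : entered H F p != [::].
    have [S [S0 SV defF]] := hF.1.
    have /set0Pn[f fF] : F != set0 by rewrite defF; apply: cut_neq0.
    have /mapP[[e w] sp /= fe] := covp f (subsetP (minimal_cut_edges hF) f fF).
    rewrite -size_eq0 size_map size_filter -lt0n -has_count.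
    by apply/hasP; exists (e, w); rewrite //= -fe.
  exists J; split.
  - apply/andP; split.
      have [i iJ _] := pJ v (mem_head _ _).
      by rewrite card_gt0; apply/set0Pn; exists i.
    apply: leq_trans (size_entered H F Up); apply: leq_trans (card_size _).
    (* Injectivity of [C] lets components be counted instead of indices; each visited one occurs in
       [entered H F p]. *)
    rewrite -(card_imset _ hCinj); apply: subset_leq_card.
    apply/subsetP=> _ /imsetP[i + ->]; rewrite inE => /hasP[w wp wC].
    have [x xV Ci] := repC i; rewrite Ci.
    have <- : reach_component K w = reach_component K x.
      by apply: reach_component_eq; move: wC; rewrite /= Ci.
    exact: closed_visited_entered Hp pv nil wp.
  - set W := \bigcup_(j in J) _.
    have pW : {subset v :: [seq s.2 | s <- p] <= W}.
      by move=> w /pJ[i iJ wC]; apply/bigcupP; exists i.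
    have vW : v \in W by apply: pW; apply: mem_head.
    exists v, p; split; last by move=> e /=; rewrite inE => /andP[/covp].
    rewrite /closed_trail /closed_walk /walk pv eqxx p2 Up vW.
    by rewrite induced_steps // => w wp; apply: pW; rewrite inE wp orbT.
  (* The tour traverses any edge of [C i], and that edge lies inside [(C i).1], so the tour visits
     [C i]. *)
  - move=> i; apply: contraNeq => /set0Pn[e /=].
    have [x xV Ci] := repC i; rewrite Ci inE => /andP[eK ex].
    have eH : e \in edges H by case/setDP: eK.
    have [w we wp] := edge_traversed Hp (covp e eH).
    rewrite inE; apply/hasP; exists w; first by rewrite inE wp orbT.
    by rewrite /= Ci; apply: subsetP (reach_class_ends eK ex) w we.
case=> /andP[J1 _] + emptyC; set W := \bigcup_(j in J) _.
apply: euler_tour_of_induced.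
  apply/bigcupsP=> j _ /=; have [x xV ->] := repC j.
  exact: reach_class_vertices hK xV.
have meetW j e : j \in J -> ends H e :&: (C j).1 != set0 ->
    ends H e :&: W != set0.
  move=> jJ /set0Pn[y /setIP[ye yC]]; apply/set0Pn; exists y.
  by rewrite inE ye; apply/bigcupP; exists j.
(* An edge of [F] meets every component, in particular one indexed by the non-empty [J]. *)
move=> e eE; have [eF | eF] := boolP (e \in F).
  move: J1; rewrite card_gt0 => /set0Pn[j jJ]; apply: (meetW j) => //.
  by have [x xV ->] := repC j; apply: minimal_cut_meets_class.
(* An edge outside [F] has a vertex and belongs to the component of that vertex; not being empty,
   this component is indexed by [J]. *)
have /set0Pn[y ye] := hne e eE.
have yV : y \in vertices H by case: hH => _ /(_ e eE)/subsetP; apply.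
have [i Ci] := indexC y yV.
have ey : ends H e :&: (C i).1 != set0.
  by apply/set0Pn; exists y; rewrite Ci !inE ye /=.
apply: meetW ey; apply/negPn/negP=> /emptyC/setP/(_ e) /=.
rewrite Ci /reach_component !inE eF eE /= => /negbT/negP[].
by apply/set0Pn; exists y; rewrite !inE ye /=.
Qed.
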